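(* Let $0<q<1$, $N\ge1$ an integer, $\mathcal X=\{0,1,\dots,N\}$, $0<a<1$, $b<1$, $0<c<1$, and let $$K(x,y)=\sum_{z=\max(x,y)}^{N}\pi(x,z,c,a)\,\pi(z-y,N-y,a,b)\qquad(x,y\in\mathcal X),$$ where $\pi$ is the $q$-Hahn measure. Then $K(x,y)\ge0$, $\sum_{x\in\mathcal X}K(x,y)=1$, the symmetry condition $$K(x,y)\,\pi(y,N,c,ab)=K(y,x)\,\pi(x,N,c,ab)\qquad(x,y\in\mathcal X)$$ holds, and for all $n,x\in\mathcal X$ $$\sum_{y\in\mathcal X}K(x,y)\,\pi(y,N,c,ab)\,\check P_n(y,c,ab)=\kappa(n)\,\pi(x,N,c,ab)\,\check P_n(x,c,ab),$$ with $$\kappa(n)=\sum_{k=0}^{n}\frac{(q^{-n};q)_k(abcq^{n-1};q)_k(a;q)_k}{(ac;q)_k(ab;q)_k(q;q)_k}q^k=\frac{a^n(b;q)_n(c;q)_n}{(ab;q)_n(ac;q)_n}.$$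
   Context: $(a;q)_n=\prod_{i=0}^{n-1}(1-aq^i)$. The $q$-Hahn measure with parameters $0<a<1$, $b<1$ is, for integers $0\le x\le M$, $\pi(x,M,a,b)=\frac{(q;q)_M}{(q;q)_x(q;q)_{M-x}}\frac{(a;q)_x(b;q)_{M-x}a^{M-x}}{(ab;q)_M}$. The $q$-Hahn polynomials on $\mathcal X$ are $\check P_n(x,a,b)=\sum_{k=0}^n\frac{(q^{-n};q)_k(abq^{n-1};q)_k(q^{-x};q)_k}{(a;q)_k(q^{-N};q)_k(q;q)_k}q^k$. *)

(* Defs.v *)
From mathcomp Require Import all_boot all_order all_algebra.
Set Implicit Arguments.
Unset Strict Implicit.
Unset Printing Implicit Defensive.

Import Order.TTheory GRing.Theory Num.Theory.
Local Open Scope ring_scope.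

Definition qpoch (R : realFieldType) (q a : R) (n : nat) : R :=
  \prod_(i < n) (1 - a * q ^+ i).

(* Meaningful for x <= M: [M - x] is truncated subtraction on nat. *)
Definition qHahn (R : realFieldType) (q : R) (x M : nat) (a b : R) : R :=
  qpoch q q M / (qpoch q q x * qpoch q q (M - x))
  * (qpoch q a x * qpoch q b (M - x) * a ^+ (M - x) / qpoch q (a * b) M).

(* Meaningful for n <= N, which keeps (q^{-N};q)_k nonzero. The power
   q^{n-1} has an integer exponent, as n may be 0. *)
Definition qHahnPoly (R : realFieldType) (q : R) (N n x : nat) (a b : R) : R :=
  \sum_(k < n.+1)
    (qpoch q (q ^- n) k * qpoch q (a * b * q ^ (n%:Z - 1)) k
       * qpoch q (q ^- x) k)
    / (qpoch q a k * qpoch q (q ^- N) k * qpoch q q k)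
    * q ^+ k.

Definition kernel (R : realFieldType) (q : R) (N : nat) (a b c : R)
    (x y : nat) : R :=
  \sum_(maxn x y <= z < N.+1) qHahn q x z c a * qHahn q (z - y) (N - y) a b.

Definition kappa (R : realFieldType) (q a b c : R) (n : nat) : R :=
  \sum_(k < n.+1)
    (qpoch q (q ^- n) k * qpoch q (a * b * c * q ^ (n%:Z - 1)) k * qpoch q a k)
    / (qpoch q (a * c) k * qpoch q (a * b) k * qpoch q q k)
    * q ^+ k.

(* Main.v *)
Require Import Defs.
From mathcomp Require Import all_boot all_order all_algebra.
From mathcomp Require Import ring.
Set Implicit Arguments.
Unset Strict Implicit.
Unset Printing Implicit Defensive.

(** Write f_k(u, v) = (u - v)(u - vq)...(u - vq^(k-1)).  The q-binomial theorem
    sum_k [n, k] f_k(u, v) f_(n-k)(v, w) = f_n(u, w) yields the factorial moments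
    of the q-Hahn measure.  The law K(., x) is a composition: first
    z = x + w with w distributed as pi(., N-x, a, b), then y as pi(., z, c, a).
    Averaging over y maps (q^-y)_k to (q^-z)_k (c)_k / (ac)_k, hence
    P_n(., c, ab) to P_n(., ac, b).  Averaging over z acts diagonally not on
    (q^-z)_k but on f_k(q^-z, q^-N), by the factor a^k (b)_k / (ab)_k.  The
    terminating 3phi2 transformation re-expands P_n in that second basis and shows
    that the second average maps P_n(., ac, b) back to a multiple of
    P_n(., c, ab).  Reversibility turns this into the eigenvalue equation.  The
    same transformation with (q^-x; alpha, q^-N) = (a; ac, ab) sums the series
    kappa. *)

Import Order.TTheory GRing.Theory Num.Theory.
Local Open Scope ring_scope.

(** * Homogeneous q-shifted factorials and q-binomial coefficients *)

(** Equals [u^n (v/u; q)_n] for nonzero [u]; the homogeneous form keeps a meaning at [u = 0]. *)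
Definition qfall (R : realFieldType) (q u v : R) (n : nat) : R :=
  \prod_(i < n) (u - v * q ^+ i).

Definition qbin (R : realFieldType) (q : R) (n k : nat) : R :=
  qpoch q q n / (qpoch q q k * qpoch q q (n - k)).

Lemma expr_subnK (R : realFieldType) (q : R) k n :
  (k <= n)%N -> q ^+ n = q ^+ k * q ^+ (n - k).
Proof. by move=> kn; rewrite -exprD subnKC. Qed.

Lemma qpochE (R : realFieldType) (q a : R) n : qpoch q a n = qfall q 1 a n.
Proof. by []. Qed.

Lemma qfall0 (R : realFieldType) (q u v : R) : qfall q u v 0 = 1.
Proof. exact: big_ord0. Qed.

Lemma qfallSr (R : realFieldType) (q u v : R) n :
  qfall q u v n.+1 = qfall q u v n * (u - v * q ^+ n).
Proof. exact: big_ord_recr. Qed.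

Lemma qfallD (R : realFieldType) (q u v : R) m n :
  qfall q u v (m + n) = qfall q u v m * qfall q u (v * q ^+ m) n.
Proof.
elim: n => [|n IHn]; first by rewrite addn0 qfall0 mulr1.
by rewrite addnS !qfallSr IHn -!mulrA -exprD.
Qed.

Lemma qfallSl (R : realFieldType) (q u v : R) n :
  qfall q u v n.+1 = (u - v) * qfall q u (v * q) n.
Proof. by rewrite -add1n qfallD qfallSr qfall0 expr0 mul1r mulr1 expr1. Qed.

Lemma qfall_scale (R : realFieldType) (q t u v : R) n :
  qfall q (t * u) (t * v) n = t ^+ n * qfall q u v n.
Proof.
elim: n => [|n IHn]; first by rewrite !qfall0 mulr1.
by rewrite !qfallSr IHn exprS; ring.
Qed.

Lemma qpoch0 (R : realFieldType) (q a : R) : qpoch q a 0 = 1.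
Proof. exact: qfall0. Qed.

Lemma qpochSr (R : realFieldType) (q a : R) n :
  qpoch q a n.+1 = qpoch q a n * (1 - a * q ^+ n).
Proof. exact: qfallSr. Qed.

Lemma qpochD (R : realFieldType) (q a : R) m n :
  qpoch q a (m + n) = qpoch q a m * qpoch q (a * q ^+ m) n.
Proof. exact: qfallD. Qed.

Lemma qpochSl (R : realFieldType) (q a : R) n :
  qpoch q a n.+1 = (1 - a) * qpoch q (a * q) n.
Proof. exact: qfallSl. Qed.

Lemma qpoch_gt0 (R : realFieldType) (q a : R) n :
  0 < q -> q < 1 -> a < 1 -> 0 < qpoch q a n.
Proof.
move=> q0 q1 a1; apply: prodr_gt0 => i _; rewrite subr_gt0.
have qi0 : 0 < q ^+ i by rewrite exprn_gt0.
have qi1 : q ^+ i <= 1 by rewrite exprn_ile1 // ltW.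
have [a0|a0] := leP a 0.
  by apply: le_lt_trans ltr01; rewrite mulr_le0_ge0 // ltW.
by apply: le_lt_trans a1; rewrite ler_piMr // ltW.
Qed.

Lemma qpoch_neq0 (R : realFieldType) (q a : R) n :
  0 < q -> q < 1 -> a < 1 -> qpoch q a n != 0.
Proof. by move=> q0 q1 a1; rewrite lt0r_neq0 // qpoch_gt0. Qed.

Lemma qpoch_neq0_le (R : realFieldType) (q a : R) m n :
  (m <= n)%N -> qpoch q a n != 0 -> qpoch q a m != 0.
Proof. by move=> /subnKC <-; rewrite qpochD mulf_eq0 negb_or => /andP[]. Qed.

Lemma qbin_sym (R : realFieldType) (q : R) n k :
  (k <= n)%N -> qbin q n (n - k) = qbin q n k.
Proof. by move=> kn; rewrite /qbin subKn // [X in _ / X]mulrC. Qed.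

(** * q-Pascal rules and the summations they prove *)

(** The rule [[n+1, k] = [n, k-1] + q^k [n, k]], summed against [F] so that later inductions meet no
    boundary cases. *)
Lemma qbin_pascal_sum (R : realFieldType) (q : R) n (F : nat -> R) :
  0 < q -> q < 1 ->
  \sum_(k < n.+2) qbin q n.+1 k * F k
  = \sum_(k < n.+1) qbin q n k * (F k.+1 + q ^+ k * F k).
Proof.
move=> q0 q1.
have nz k : qpoch q q k != 0 by rewrite qpoch_neq0.
have nzS k : 1 - q ^+ k.+1 != 0.
  by have := nz k.+1; rewrite qpochSr mulf_eq0 negb_or -exprS => /andP[].
apply: (mulfI (nzS n)).
(* Uses [1 - q^(n+1) = (1 - q^k) + q^k (1 - q^(n+1-k))]; the first part vanishes at [k = 0], the
   second at [k = n+1]. *)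
have split_term (k : 'I_n.+2) : (1 - q ^+ n.+1) * (qbin q n.+1 k * F k)
   = qbin q n.+1 k * (1 - q ^+ k) * F k
     + qbin q n.+1 k * (1 - q ^+ (n.+1 - k)) * (q ^+ k * F k).
  by rewrite (expr_subnK q (ltn_ord k : k <= n.+1)%N); ring.
rewrite mulr_sumr (eq_bigr _ (fun k _ => split_term k)) big_split /=.
rewrite big_ord_recl expr0 subrr mulr0 mul0r add0r.
rewrite [X in _ + X]big_ord_recr /= subnn expr0 subrr mulr0 mul0r addr0.
rewrite -big_split mulr_sumr; apply: eq_bigr => k _ /=.
have kn : (k <= n)%N by rewrite -ltnS.
rewrite /bump /= add1n /qbin subSS subSn // !qpochSr -!exprS.
by field; rewrite !nz !nzS.
Qed.

(** The other rule, [[n+1, k] = [n, k] + q^(n+1-k) [n, k-1]], by the reflection [k -> n+1-k]. *)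
Lemma qbin_pascal_sum_rev (R : realFieldType) (q : R) n (F : nat -> R) :
  0 < q -> q < 1 ->
  \sum_(k < n.+2) qbin q n.+1 k * F k
  = \sum_(k < n.+1) qbin q n k * (F k + q ^+ (n - k) * F k.+1).
Proof.
move=> q0 q1; transitivity (\sum_(k < n.+2) qbin q n.+1 k * F (n.+1 - k)%N).
  rewrite (reindex_inj rev_ord_inj) /=; apply: eq_bigr => k _.
  by rewrite subSS qbin_sym // -ltnS.
rewrite (qbin_pascal_sum n (fun k => F (n.+1 - k)%N) q0 q1).
rewrite [RHS](reindex_inj rev_ord_inj) /=; apply: eq_bigr => k _.
have kn : (k <= n)%N by rewrite -ltnS.
by rewrite !subSS qbin_sym // subKn // subSn.
Qed.

(** In the induction the two Pascal terms share a factor, and [(u - v q^k) + q^k (v - w q^(n-k)) = u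
    - w q^n] no longer depends on [k]. *)
Lemma qfall_binomial (R : realFieldType) (q u v w : R) n :
  0 < q -> q < 1 ->
  \sum_(k < n.+1) qbin q n k * (qfall q u v k * qfall q v w (n - k))
  = qfall q u w n.
Proof.
move=> q0 q1; elim: n => [|n IHn].
  by rewrite big_ord1 /qbin subnn !qpoch0 !qfall0 !mulr1 divr1.
rewrite (qbin_pascal_sum n (fun k => qfall q u v k * qfall q v w (n.+1 - k)) q0 q1).
rewrite qfallSr -IHn mulr_suml; apply: eq_bigr => k _.
have kn : (k <= n)%N by rewrite -ltnS.
rewrite subSS subSn // !qfallSr (expr_subnK q kn); ring.
Qed.

(** Expands [(X)_n] in the basis [f_j(X, D)]. The induction needs all [D]: the two Pascal terms are
    instances at [D] and [D q], and [(1 - D q^n) - q^n (X - D) = 1 - X q^n]. *)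
Lemma qfall_pochhammer_sum (R : realFieldType) (q X D : R) n :
  0 < q -> q < 1 ->
  \sum_(j < n.+1) qbin q n j
    * (qfall q 0 1 j * qfall q X D j * qpoch q (D * q ^+ j) (n - j))
  = qpoch q X n.
Proof.
move=> q0 q1; elim: n D => [|n IHn] D.
  by rewrite big_ord1 /qbin subnn !qpoch0 !qfall0 !mulr1 divr1.
rewrite (qbin_pascal_sum_rev n (fun j => qfall q 0 1 j * qfall q X D j
    * qpoch q (D * q ^+ j) (n.+1 - j)) q0 q1).
transitivity ((1 - D * q ^+ n) * qpoch q X n - q ^+ n * (X - D) * qpoch q X n);
  last by rewrite qpochSr; ring.
rewrite -{1}(IHn D) -(IHn (D * q)) !mulr_sumr -sumrB; apply: eq_bigr => j _.
have jn : (j <= n)%N by rewrite -ltnS.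
rewrite subSS subSn // qpochSr (qfallSl q X) (qfallSr q 0) exprS (mulrA D).
by rewrite (expr_subnK q jn); ring.
Qed.

(** The q-Chu-Vandermonde sum cleared of denominators. The Pascal terms are instances at
    [(B q, C q)] and [(B, C)]. *)
Lemma pochhammer_qfall_sum (R : realFieldType) (q B C : R) n :
  0 < q -> q < 1 ->
  \sum_(m < n.+1) qbin q n m
    * (qfall q 0 1 (n - m) * qpoch q B m * qpoch q (C * q ^+ m) (n - m))
  = qfall q 0 1 n * qfall q B C n.
Proof.
move=> q0 q1; elim: n B C => [|n IHn] B C.
  by rewrite big_ord1 /qbin subnn !qpoch0 !qfall0 !mulr1 divr1.
rewrite (qbin_pascal_sum n (fun m => qfall q 0 1 (n.+1 - m) * qpoch q B m
    * qpoch q (C * q ^+ m) (n.+1 - m)) q0 q1).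
transitivity ((1 - B) * (qfall q 0 1 n * qfall q (B * q) (C * q) n)
   - q ^+ n * (1 - C * q ^+ n) * (qfall q 0 1 n * qfall q B C n)); last first.
  by rewrite ![_ * q]mulrC qfall_scale !qfallSr; ring.
rewrite -(IHn (B * q)) -(IHn B C) !mulr_sumr -sumrB; apply: eq_bigr => m _.
have mn : (m <= n)%N by rewrite -ltnS.
rewrite subSS subSn // (qpochSr q (C * q ^+ m)) (qpochSl q B) (qfallSr q 0).
rewrite exprS (mulrA C).
by rewrite (expr_subnK q mn); ring.
Qed.

(** * Evaluation at integer powers of [q], and the q-Chu-Vandermonde sum *)

Lemma qfall_exprn0 (R : realFieldType) (q : R) n k :
  (n < k)%N -> qfall q (q ^+ n) 1 k = 0.
Proof.
by move=> nk; rewrite /qfall (bigD1 (Ordinal nk)) //= mul1r subrr mul0r.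
Qed.

(** Since [q^n - q^i = -q^i (1 - q^(n-i))], the left factor is a q-falling factorial of [n] up to
    [f_k(0, 1)]. *)
Lemma qfall_exprn (R : realFieldType) (q : R) n k :
  (k <= n)%N ->
  qfall q (q ^+ n) 1 k * qpoch q q (n - k) = qfall q 0 1 k * qpoch q q n.
Proof.
elim: k => [|k IHk] kn; first by rewrite subn0 !qfall0.
rewrite (qfallSr q 0) mulrAC -(IHk (ltnW kn)) subnS -(subnSK kn) qpochSr qfallSr.
by rewrite (expr_subnK q (ltnW kn)) -(subnSK kn) exprS; ring.
Qed.

Lemma qpoch_exprVn (R : realFieldType) (q : R) n k :
  q != 0 -> qpoch q (q ^- n) k = qfall q (q ^+ n) 1 k / q ^+ (n * k).
Proof.
move=> q0; have qn0 : q ^+ n != 0 by rewrite expf_neq0.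
rewrite -[X in qfall q X]mulr1 -[X in qfall q _ X](mulfV qn0) qfall_scale.
by rewrite -exprM [X in X / _]mulrC mulfK // expf_neq0.
Qed.

(** Here f_n(0, 1) = (-1)^n q^(n(n-1)/2) is the usual sign factor. *)
Lemma qfall01_mul (R : realFieldType) (q : R) j m :
  qfall q 0 1 (j + m) * qfall q 0 1 m * q ^+ m
  = qfall q 0 1 j * q ^+ ((j + m) * m).
Proof.
elim: m => [|m IHm]; first by rewrite addn0 muln0 qfall0 !mulr1.
rewrite addnS !qfallSr.
have -> : ((j + m).+1 * m.+1 = (j + m) * m + (j + m) + m + 1)%N by ring.
by rewrite exprS !exprD expr1 !mulrA -IHm; ring.
Qed.

(** Absorption: [[n, y] f_k(q^y, 1) = f_k(q^n, 1) [n-k, y-k]], and terms with [y < k] vanish. Both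
    factorial moments start from it. *)
Lemma sum_qbin_qfall (R : realFieldType) (q : R) n k (G : nat -> R) :
  0 < q -> q < 1 ->
  \sum_(y < n.+1) qbin q n y * (qfall q (q ^+ y) 1 k * G y)
  = qfall q (q ^+ n) 1 k * \sum_(m < (n - k).+1) qbin q (n - k) m * G (k + m)%N.
Proof.
move=> q0 q1; have nz i : qpoch q q i != 0 by rewrite qpoch_neq0.
(* For [n < k] the truncated [n - k] is harmless: the factor [f_k(q^n, 1)] is 0. *)
have [kn|nk] := leqP k n; last first.
  rewrite qfall_exprn0 // mul0r big1 // => y _.
  by rewrite qfall_exprn0 ?mul0r ?mulr0 //; apply: leq_trans nk.
rewrite -(big_mkord xpredT (fun y => qbin q n y * (qfall q (q ^+ y) 1 k * G y))).
rewrite (big_cat_nat (n := k)) //=; last exact: leqW.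
rewrite big_nat big1 ?add0r => [|y yk]; last by rewrite qfall_exprn0 ?mul0r ?mulr0.
rewrite -{1}[k]add0n big_addn subSn // big_mkord mulr_sumr.
apply: eq_bigr => m _; rewrite [(m + k)%N]addnC mulrA [RHS]mulrA; congr (_ * _).
have kkm : (k <= k + m)%N := leq_addr m k.
have := qfall_exprn q kkm; have := qfall_exprn q kn.
rewrite addKn /qbin subnDA => /(canRL (mulfK (nz _))) -> /(canRL (mulfK (nz _))) ->.
by field; rewrite !nz.
Qed.

(** Gasper-Rahman (II.6), with no division by [B]. *)
Lemma q_chu_vandermonde (R : realFieldType) (q B C : R) n :
  0 < q -> q < 1 -> qpoch q C n != 0 ->
  \sum_(m < n.+1) qpoch q (q ^- n) m * qpoch q B m
      / (qpoch q C m * qpoch q q m) * q ^+ m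
  = qfall q B C n / qpoch q C n.
Proof.
move=> q0 q1 Cn; have qn0 : q != 0 by rewrite lt0r_neq0.
have nz i : qpoch q q i != 0 by rewrite qpoch_neq0.
have sn0 i : qfall q 0 1 i != 0.
  by apply/prodf_neq0 => j _; rewrite mul1r sub0r oppr_eq0 expf_neq0.
apply: (mulfI (sn0 n)); rewrite mulrA -pochhammer_qfall_sum // mulr_sumr mulr_suml.
apply: eq_bigr => m _; have mn : (m <= n)%N by rewrite -ltnS.
have Cm := qpoch_neq0_le mn Cn.
(* Trades [f_(n-m)(0, 1)] for [f_n(0, 1) f_m(0, 1)], with the power [q^(nm)] that [(q^-n)_m] carries
   in its denominator. *)
have := qfall01_mul q (n - m) m; rewrite subnK // => e1.
have := qfall_exprn q mn => /(canRL (mulfK (nz _))) e2.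
have e3 : qpoch q C n = qpoch q C m * qpoch q (C * q ^+ m) (n - m).
  by rewrite -qpochD subnKC.
have Cnm : qpoch q (C * q ^+ m) (n - m) != 0.
  by move: Cn; rewrite e3 mulf_eq0 negb_or => /andP[].
have e4 : qfall q 0 1 (n - m)
    = qfall q 0 1 n * qfall q 0 1 m * q ^+ m / q ^+ (n * m).
  by rewrite e1 mulfK // expf_neq0.
rewrite qpoch_exprVn // e2 e3 e4 /qbin.
by field; rewrite !nz Cm Cnm expf_neq0.
Qed.

(** * The terminating 3phi2 transformation *)

(** Reads the factors backwards: [B = b q^(m-1)], a relation written without the exponent [m-1]. *)
Lemma qfall_reverse (R : realFieldType) (q b B : R) m :
  q != 0 -> B * q = b * q ^+ m -> qfall q B 1 m = qfall q 0 1 m * qpoch q b m.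
Proof.
move=> q0; elim: m B => [|m IHm] B; first by rewrite !qfall0 qpoch0 mulr1.
rewrite exprSr mulrA => /(mulIf q0) BE.
have e : qfall q B q m = q ^+ m * qfall q (B / q) 1 m.
  by rewrite -qfall_scale mulr1 mulrC divfK.
rewrite qfallSl mul1r e.
by rewrite IHm ?divfK // BE qfallSr qpochSr; ring.
Qed.

Lemma sum_triangle (R : realFieldType) n (U : nat -> nat -> R) :
  \sum_(k < n.+1) \sum_(j < k.+1) U k j
  = \sum_(j < n.+1) \sum_(m < (n - j).+1) U (j + m)%N j.
Proof.
elim: n => [|n IHn]; first by rewrite !big_ord1.
rewrite big_ord_recr IHn [RHS]big_ord_recr /=.
rewrite [X in _ + X = _](big_ord_recr n.+1) /= addrA.
rewrite subnn big_ord1 addn0 -big_split; congr (_ + _); apply: eq_bigr => j _ /=.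
have jn : (j <= n)%N by rewrite -ltnS.
by rewrite subSn // [RHS]big_ord_recr /= addnS subnKC.
Qed.

(** The terminating series 3phi2([q^-n, A, X; C, D; q, q]), of which [qHahnPoly] and [kappa] are
    both instances. *)
Definition phi32 (R : realFieldType) (q : R) (n : nat) (A X C D : R) : R :=
  \sum_(k < n.+1)
    (qpoch q (q ^- n) k * qpoch q A k * qpoch q X k)
    / (qpoch q C k * qpoch q D k * qpoch q q k) * q ^+ k.

(** Gasper-Rahman (III.12); f_n(0, C) = (-C)^n q^(n(n-1)/2) and
    f_j(X, D) = X^j (D/X)_j clear the denominators [b] and [X], so that [b = 0]
    is allowed. *)
Lemma phi32_transform (R : realFieldType) (q A X C D b : R) n :
  0 < q -> q < 1 -> C != 0 -> A * q = C * b * q ^+ n ->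
  qpoch q C n != 0 -> qpoch q D n != 0 -> qpoch q b n != 0 ->
  phi32 q n A X C D
  = qfall q 0 C n * (qpoch q b n / qpoch q C n)
    * \sum_(j < n.+1) qpoch q (q ^- n) j * qpoch q A j * qfall q X D j
        / (qpoch q D j * qpoch q b j * qpoch q q j) * (q / C) ^+ j.
Proof.
move=> q0 q1 C0 AE Cn Dn bn; have qn0 : q != 0 by rewrite lt0r_neq0.
have nz i : qpoch q q i != 0 by rewrite qpoch_neq0.
(* The double summand obtained by expanding [(X)_k / (D)_k] with [qfall_pochhammer_sum]. *)
pose U k j := qpoch q (q ^- n) k * qpoch q A k / (qpoch q C k * qpoch q q k)
  * q ^+ k * (qbin q k j * (qfall q 0 1 j * qfall q X D j / qpoch q D j)).
transitivity (\sum_(k < n.+1) \sum_(j < k.+1) U k j).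
  apply: eq_bigr => k _; have kn : (k <= n)%N by rewrite -ltnS.
  have Dk := qpoch_neq0_le kn Dn.
  rewrite -mulr_sumr.
  have -> : \sum_(j < k.+1) qbin q k j * (qfall q 0 1 j * qfall q X D j / qpoch q D j)
     = qpoch q X k / qpoch q D k.
    rewrite -(qfall_pochhammer_sum X D k q0 q1) mulr_suml; apply: eq_bigr => j _.
    have jk : (j <= k)%N by rewrite -ltnS.
    have e : qpoch q D k = qpoch q D j * qpoch q (D * q ^+ j) (k - j).
      by rewrite -qpochD subnKC.
    move: Dk; rewrite e mulf_eq0 negb_or => /andP[D1 D2].
    by rewrite /qbin; field; rewrite D1 D2 !nz.
  by field; rewrite Dk nz (qpoch_neq0_le kn Cn).
rewrite sum_triangle mulr_sumr; apply: eq_bigr => j _.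
have jn : (j <= n)%N by rewrite -ltnS.
have splitn a : qpoch q a n = qpoch q a j * qpoch q (a * q ^+ j) (n - j).
  by rewrite -qpochD subnKC.
move: (Cn) (bn); rewrite !splitn !mulf_eq0 !negb_or => /andP[C1 C2] /andP[b1 b2].
have Dj := qpoch_neq0_le jn Dn.
(* After the exchange the inner sum is q-Chu-Vandermonde of order [n-j] at [A q^j, C q^j]. *)
have -> : \sum_(m < (n - j).+1) U (j + m)%N j
  = qpoch q (q ^- n) j * qpoch q A j / (qpoch q C j * qpoch q q j) * q ^+ j
    * (qfall q 0 1 j * qfall q X D j / qpoch q D j)
    * (qfall q (A * q ^+ j) (C * q ^+ j) (n - j) / qpoch q (C * q ^+ j) (n - j)).
  rewrite -q_chu_vandermonde // mulr_sumr; apply: eq_bigr => m _.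
  have mnj : (m <= n - j)%N by rewrite -ltnS.
  have e : q ^- n * q ^+ j = q ^- (n - j).
    by rewrite (expr_subnK q jn); field; rewrite !expf_neq0.
  rewrite /U /qbin addKn !(qpochD q _ j m) e exprD.
  have := nz (j + m)%N; rewrite (qpochD q q j m) mulf_eq0 negb_or => /andP[q2 q3].
  by field; rewrite q2 q3 !nz C1 Dj (qpoch_neq0_le mnj C2).
have s0 : qfall q 0 1 n
    = qfall q 0 1 j * (q ^+ (j * (n - j)) * qfall q 0 1 (n - j)).
  by rewrite -{1}(subnKC jn) qfallD mul1r exprM -qfall_scale mulr0 mulr1.
have sC : qfall q 0 C n = C ^+ j * C ^+ (n - j) * qfall q 0 1 n.
  by rewrite -expr_subnK // -qfall_scale mulr0 mulr1.
(* The relation between [A], [C] and [b] enters here: [(A/C) q = (b q^j) q^(n-j)] lets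
   [qfall_reverse] produce [(b q^j)_(n-j)]. *)
have -> : qfall q (A * q ^+ j) (C * q ^+ j) (n - j)
  = q ^+ (j * (n - j)) * (C ^+ (n - j)
      * (qfall q 0 1 (n - j) * qpoch q (b * q ^+ j) (n - j))).
  rewrite -(@qfall_reverse _ q (b * q ^+ j) (A / C)) //; last first.
    by rewrite mulrAC AE (expr_subnK q jn); field.
  rewrite -qfall_scale mulr1 [C * (A / C)]mulrC divfK // exprM -qfall_scale.
  by rewrite ![q ^+ j * _]mulrC.
rewrite sC s0 expr_div_n.
by field; rewrite b1 nz Dj C1 C2 expf_neq0.
Qed.

(** * Mass and factorial moments of the q-Hahn measure *)

Lemma qfall_mulr (R : realFieldType) (q a b : R) n :
  qfall q a (a * b) n = a ^+ n * qpoch q b n.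
Proof. by rewrite -{1}[a]mulr1 qfall_scale. Qed.

(** Exhibits the weights as the terms of the q-binomial theorem at [(u, v, w) = (1, a, a b)]. *)
Lemma qHahnE (R : realFieldType) (q a b : R) x M :
  qHahn q x M a b
  = qbin q M x * (qfall q 1 a x * qfall q a (a * b) (M - x)) / qpoch q (a * b) M.
Proof. by rewrite qfall_mulr /qHahn /qbin -qpochE; ring. Qed.

Lemma qHahn_sum (R : realFieldType) (q a b : R) M :
  0 < q -> q < 1 -> qpoch q (a * b) M != 0 ->
  \sum_(x < M.+1) qHahn q x M a b = 1.
Proof.
move=> q0 q1 ab; under eq_bigr => x _ do rewrite qHahnE.
by rewrite -mulr_suml qfall_binomial // divff.
Qed.

Lemma qHahn_ge0 (R : realFieldType) (q a b : R) x M :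
  0 < q -> q < 1 -> 0 < a -> a < 1 -> b < 1 -> a * b < 1 ->
  0 <= qHahn q x M a b.
Proof.
move=> q0 q1 a0 a1 b1 ab1.
by rewrite /qHahn !(mulr_ge0, invr_ge0) ?exprn_ge0 ?(ltW (qpoch_gt0 _ _ _ _)) // ltW.
Qed.

(** Absorption leaves a sum over [z-k], evaluated by the q-binomial theorem at
    [(1, c q^k, c a q^k)]. *)
Lemma qHahn_qpoch_mean (R : realFieldType) (q a c : R) z k :
  0 < q -> q < 1 -> a * c < 1 ->
  \sum_(y < z.+1) qHahn q y z c a * qpoch q (q ^- y) k
  = qpoch q (q ^- z) k * (qpoch q c k / qpoch q (a * c) k).
Proof.
move=> q0 q1; rewrite [a * c]mulrC => ac1.
have qn0 : q != 0 by rewrite lt0r_neq0.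
have acn i : qpoch q (c * a) i != 0 by rewrite qpoch_neq0.
pose G y := qpoch q c y * qfall q c (c * a) (z - y) / q ^+ (y * k)
            / qpoch q (c * a) z.
transitivity (\sum_(y < z.+1) qbin q z y * (qfall q (q ^+ y) 1 k * G y)).
  by apply: eq_bigr => y _; rewrite qHahnE qpoch_exprVn // /G -qpochE; ring.
rewrite sum_qbin_qfall // qpoch_exprVn //.
have [kz|zk] := leqP k z; last by rewrite qfall_exprn0 // !mul0r.
rewrite -!mulrA; congr (_ * _).
have acz : qpoch q (c * a) z = qpoch q (c * a) k * qpoch q (c * a * q ^+ k) (z - k).
  by rewrite -qpochD subnKC.
move: (acn z); rewrite acz mulf_eq0 negb_or => /andP[ac2 ac3].
transitivity ((q ^+ (z * k))^-1 * (qpoch q c k / qpoch q (c * a) z)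
   * qpoch q (c * a * q ^+ k) (z - k)); last first.
  by rewrite acz; field; rewrite ac2 ac3 expf_neq0.
rewrite (qpochE q (c * a * q ^+ k)).
rewrite -(qfall_binomial 1 (c * q ^+ k) (c * a * q ^+ k) (z - k) q0 q1) mulr_sumr.
apply: eq_bigr => m _; have mzk : (m <= z - k)%N by rewrite -ltnS.
(* The surplus power of [q] is what rescales [f_(z-k-m)(c, c a)] to base points [c q^k, c a q^k]. *)
have e : q ^+ (z * k) = q ^+ ((k + m) * k) * q ^+ (k * (z - k - m)).
  by rewrite -exprD [(k * _)%N]mulnC -mulnDl -subnDA subnKC // -leq_subRL.
have e2 : qfall q (c * q ^+ k) (c * a * q ^+ k) (z - k - m)
    = q ^+ (k * (z - k - m)) * qfall q c (c * a) (z - (k + m)).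
  by rewrite exprM subnDA -qfall_scale ![q ^+ k * _]mulrC.
rewrite /G e e2 qpochD -qpochE acz.
by field; rewrite ac2 ac3 !expf_neq0.
Qed.

(** Reflect [w -> M-w], absorb, and split [f_k(a, a b) = a^k (b)_k] off; the rest is the q-binomial
    theorem at [(1, a, a b q^k)]. *)
Lemma qHahn_qfall_mean (R : realFieldType) (q a b : R) M k :
  0 < q -> q < 1 -> a * b < 1 ->
  \sum_(w < M.+1) qHahn q w M a b * qfall q (q ^+ (M - w)) 1 k
  = qfall q (q ^+ M) 1 k * (a ^+ k * qpoch q b k / qpoch q (a * b) k).
Proof.
move=> q0 q1 ab1.
have abn i : qpoch q (a * b) i != 0 by rewrite qpoch_neq0.
pose G y := qfall q 1 a (M - y) * qfall q a (a * b) y / qpoch q (a * b) M.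
transitivity (\sum_(y < M.+1) qbin q M y * (qfall q (q ^+ y) 1 k * G y)).
  rewrite (reindex_inj rev_ord_inj) /=; apply: eq_bigr => y _.
  have yM : (y <= M)%N by rewrite -ltnS.
  by rewrite qHahnE subSS qbin_sym // subKn // /G; ring.
rewrite sum_qbin_qfall //.
have [kM|Mk] := leqP k M; last by rewrite qfall_exprn0 // !mul0r.
congr (_ * _).
have abM : qpoch q (a * b) M = qpoch q (a * b) k * qpoch q (a * b * q ^+ k) (M - k).
  by rewrite -qpochD subnKC.
move: (abn M); rewrite abM mulf_eq0 negb_or => /andP[ab2 ab3].
transitivity (qfall q a (a * b) k / qpoch q (a * b) M
   * qpoch q (a * b * q ^+ k) (M - k)); last first.
  by rewrite qfall_mulr abM; field; rewrite ab2 ab3.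
rewrite (qpochE q (a * b * q ^+ k)).
rewrite -(qfall_binomial 1 a (a * b * q ^+ k) (M - k) q0 q1) mulr_sumr.
rewrite (reindex_inj rev_ord_inj) /=.
apply: eq_bigr => m _; have mMk : (m <= M - k)%N by rewrite -ltnS.
rewrite subSS qbin_sym // /G subnDA subKn // qfallD.
by ring.
Qed.

(** * Action of the two averages on 3phi2 series *)

(** Termwise, the moment's [(c)_k] cancels the denominator and [(a c)_k] replaces it. *)
Lemma phi32_qHahn_mean (R : realFieldType) (q A a c D : R) n z :
  0 < q -> q < 1 -> c < 1 -> a * c < 1 ->
  \sum_(y < z.+1) qHahn q y z c a * phi32 q n A (q ^- y) c D
  = phi32 q n A (q ^- z) (a * c) D.
Proof.
move=> q0 q1 c1 ac1; under eq_bigr => y _ do rewrite mulr_sumr.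
rewrite exchange_big; apply: eq_bigr => k _ /=.
have cn := qpoch_neq0 k q0 q1 c1.
transitivity (qpoch q (q ^- n) k * qpoch q A k
   / (qpoch q c k * qpoch q D k * qpoch q q k) * q ^+ k
   * \sum_(y < z.+1) qHahn q y z c a * qpoch q (q ^- y) k).
  by rewrite mulr_sumr; apply: eq_bigr => y _; ring.
rewrite qHahn_qpoch_mean // !invfM.
transitivity (qpoch q c k / qpoch q c k
  * (qpoch q (q ^- n) k * qpoch q A k * qpoch q (q ^- z) k
     * (qpoch q (a * c) k)^-1 * (qpoch q D k)^-1 * (qpoch q q k)^-1 * q ^+ k)).
  by ring.
by rewrite divff //; ring.
Qed.

Lemma qpoch_exprVN_neq0 (R : realFieldType) (q : R) n N :
  0 < q -> q < 1 -> (n <= N)%N -> qpoch q (q ^- N) n != 0.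
Proof.
move=> q0 q1 nN; have qn0 : q != 0 by rewrite lt0r_neq0.
rewrite qpoch_exprVn // mulf_neq0 ?invr_eq0 ?expf_neq0 //.
have nz i : qpoch q q i != 0 by rewrite qpoch_neq0.
apply: contraTneq (oner_neq0 R) => e; have := qfall_exprn q nN.
rewrite e mul0r => /esym/eqP.
rewrite mulf_eq0 (negPf (nz _)) orbF => /prodf_eq0[i _].
by rewrite mul1r sub0r oppr_eq0 expf_eq0 (negPf qn0) andbF.
Qed.

(** Both sides are transformed, with last parameter [b] on the left and [a b] on the right. The
    moment [a^j (b)_j / (a b)_j] then turns one series into the other, and the prefactors give the
    eigenvalue. *)
Lemma phi32_qHahn_shift_mean (R : realFieldType) (q A a b c : R) n x N :
  0 < q -> q < 1 -> a != 0 -> b < 1 -> c != 0 -> c < 1 ->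
  a * b < 1 -> a * c < 1 ->
  A * q = a * b * c * q ^+ n -> (n <= N)%N -> (x <= N)%N ->
  \sum_(w < (N - x).+1) qHahn q w (N - x) a b
      * phi32 q n A (q ^- (x + w)) (a * c) (q ^- N)
  = a ^+ n * qpoch q b n * qpoch q c n / (qpoch q (a * b) n * qpoch q (a * c) n)
    * phi32 q n A (q ^- x) c (q ^- N).
Proof.
move=> q0 q1 a0 b1 c0 c1 ab1 ac1 AE nN xN.
have qn0 : q != 0 by rewrite lt0r_neq0.
have bz i : qpoch q b i != 0 by rewrite qpoch_neq0.
have cz i : qpoch q c i != 0 by rewrite qpoch_neq0.
have abz i : qpoch q (a * b) i != 0 by rewrite qpoch_neq0.
have acz i : qpoch q (a * c) i != 0 by rewrite qpoch_neq0.
have Nz := qpoch_exprVN_neq0 q0 q1 nN.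
have fallN z j : (z <= N)%N ->
    qfall q (q ^- z) (q ^- N) j = (q ^- N) ^+ j * qfall q (q ^+ (N - z)) 1 j.
  move=> zN; rewrite -qfall_scale mulr1 (expr_subnK q zN).
  by congr qfall; field; rewrite !expf_neq0.
(* Only the right-hand side is rewritten: the series on the left depends on the bound [w]. *)
rewrite (@phi32_transform _ _ _ _ _ _ (a * b)) //; last by rewrite AE; ring.
have -> : \sum_(w < (N - x).+1) qHahn q w (N - x) a b
      * phi32 q n A (q ^- (x + w)) (a * c) (q ^- N)
  = qfall q 0 (a * c) n * (qpoch q b n / qpoch q (a * c) n)
    * \sum_(j < n.+1) qpoch q (q ^- n) j * qpoch q A j
        / (qpoch q (q ^- N) j * qpoch q b j * qpoch q q j) * (q / (a * c)) ^+ j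
        * ((q ^- N) ^+ j
        * \sum_(w < (N - x).+1) qHahn q w (N - x) a b
            * qfall q (q ^+ (N - x - w)) 1 j).
  transitivity (\sum_(w < (N - x).+1) qfall q 0 (a * c) n
     * (qpoch q b n / qpoch q (a * c) n) * \sum_(j < n.+1)
       qpoch q (q ^- n) j * qpoch q A j
        / (qpoch q (q ^- N) j * qpoch q b j * qpoch q q j) * (q / (a * c)) ^+ j
        * ((q ^- N) ^+ j * (qHahn q w (N - x) a b
              * qfall q (q ^+ (N - x - w)) 1 j))).
    apply: eq_bigr => w _.
    rewrite (@phi32_transform _ _ _ _ _ _ b) ?mulf_neq0 //; last first.
      by rewrite AE; ring.
    rewrite mulrCA; congr (_ * _); rewrite mulr_sumr; apply: eq_bigr => j _.
    have wN : (x + w <= N)%N by rewrite -leq_subRL // -ltnS.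
    by rewrite fallN // subnDA; ring.
  rewrite -mulr_sumr exchange_big; congr (_ * _); apply: eq_bigr => j _ /=.
  by rewrite -!mulr_sumr.
have -> : qfall q 0 (a * c) n = a ^+ n * qfall q 0 c n.
  by rewrite -qfall_scale mulr0.
rewrite [RHS]mulrA; congr (_ * _); first by field; rewrite abz acz cz.
apply: eq_bigr => j _; have jn : (j <= n)%N by rewrite -ltnS.
rewrite qHahn_qfall_mean // fallN // !expr_div_n exprMn.
by field; rewrite !expf_neq0 // bz abz qpoch_neq0 // (qpoch_neq0_le jn).
Qed.

(** * The kernel as a composition, its reversibility, and the sum [kappa] *)

(** The bound [max(y, x) <= z] separates into [x <= z] and [y <= z], so the sums over [y] and
    [z = x + w] can be exchanged. *)
Lemma kernel_sum (R : realFieldType) (q a b c : R) (N x : nat) (F : nat -> R) :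
  (x <= N)%N ->
  \sum_(y < N.+1) kernel q N a b c y x * F y
  = \sum_(w < (N - x).+1) qHahn q w (N - x) a b
      * \sum_(y < (x + w).+1) qHahn q y (x + w) c a * F y.
Proof.
move=> xN; pose H z := qHahn q (z - x) (N - x) a b
  * \sum_(y < z.+1) qHahn q y z c a * F y.
transitivity (\sum_(x <= z < N.+1) H z); last first.
  rewrite -{1}[x]add0n big_addn subSn // big_mkord; apply: eq_bigr => w _.
  by rewrite /H addnK addnC.
rewrite big_geq_mkord /=.
under eq_bigr => y _ do rewrite /kernel big_geq_mkord mulr_suml big_mkcond /=.
rewrite exchange_big [RHS]big_mkcond; apply: eq_bigr => z _ /=.
have zN : (z < N.+1)%N by [].
under eq_bigr => y _ do rewrite geq_max.
case: (x <= z)%N; last by rewrite big1 // => y _; rewrite andbF.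
rewrite /H (big_ord_widen_cond _ xpredT (fun y => qHahn q y z c a * F y) zN).
rewrite [RHS]mulr_sumr [RHS]big_mkcond; apply: eq_bigr => y _ /=.
by rewrite andbT ltnS; case: (y <= z)%N => //; ring.
Qed.

(** The identity holds for each [z] separately: the factors [(q)_(N-t)] and [(a b)_(N-t)] cancel,
    leaving a product symmetric in the two states. *)
Lemma kernel_reversible (R : realFieldType) (q a b c : R) N x y :
  0 < q -> q < 1 -> a * b < 1 -> (x <= N)%N -> (y <= N)%N ->
  kernel q N a b c x y * qHahn q y N c (a * b)
  = kernel q N a b c y x * qHahn q x N c (a * b).
Proof.
move=> q0 q1 ab1 xN yN; rewrite /kernel maxnC !mulr_suml.
have nz i : qpoch q q i != 0 by rewrite qpoch_neq0.
have abz i : qpoch q (a * b) i != 0 by rewrite qpoch_neq0.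
rewrite big_nat [RHS]big_nat; apply: eq_bigr => z.
rewrite geq_max => /andP[/andP[yz xz] zN].
have zN' : (z <= N)%N by [].
(* [W] gathers what is independent of both states, [V t] what belongs to the state [t]. *)
pose W := qpoch q q z * qpoch q q N * (qpoch q q (N - z))^-1
  * (qpoch q (c * a) z)^-1 * (qpoch q (c * (a * b)) N)^-1
  * qpoch q b (N - z) * a ^+ (N - z) * c ^+ (N - z).
pose V t := qpoch q c t * qpoch q a (z - t) * c ^+ (z - t)
  * (qpoch q q t)^-1 * (qpoch q q (z - t))^-1.
have factored t u : (t <= z)%N ->
  qHahn q u z c a * qHahn q (z - t) (N - t) a b * qHahn q t N c (a * b)
  = W * V u * V t.
  move=> tz; have tN := leq_trans tz zN'.
  have e1 : (N - t - (z - t) = N - z)%N by rewrite -subnDA subnKC.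
  have e2 : c ^+ (N - t) = c ^+ (N - z) * c ^+ (z - t).
    by rewrite -exprD addnBA // subnK.
  rewrite /qHahn e1 e2 !invfM /W /V.
  transitivity (qpoch q q (N - t) / qpoch q q (N - t)
    * (qpoch q (a * b) (N - t) / qpoch q (a * b) (N - t)) * (W * V u * V t)).
    by rewrite /W /V; ring.
  by rewrite !divff // /W /V; ring.
by rewrite !factored //; ring.
Qed.

Lemma kappaE (R : realFieldType) (q a b c : R) n :
  0 < q -> q < 1 -> a != 0 -> c != 0 -> b < 1 -> a * b < 1 -> a * c < 1 ->
  kappa q a b c n
  = a ^+ n * qpoch q b n * qpoch q c n / (qpoch q (a * b) n * qpoch q (a * c) n).
Proof.
move=> q0 q1 a0 c0 b1 ab1 ac1; have qn0 : q != 0 by rewrite lt0r_neq0.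
have bz i : qpoch q b i != 0 by rewrite qpoch_neq0.
have qz i : qpoch q q i != 0 by rewrite qpoch_neq0.
have abz i : qpoch q (a * b) i != 0 by rewrite qpoch_neq0.
have acz i : qpoch q (a * c) i != 0 by rewrite qpoch_neq0.
pose A := a * b * c * q ^ (n%:Z - 1).
have Aq : A * q = a * b * c * q ^+ n.
  by rewrite /A -mulrA -{2}[q]expr1z -expfzDr // subrK.
have -> : kappa q a b c n = phi32 q n A a (a * c) (a * b) by [].
rewrite (@phi32_transform _ _ _ _ _ _ b) ?mulf_neq0 //; last by rewrite Aq; ring.
(* With [X = q^(1-n)/c], [(A)_j] becomes [f_j(X, a b)] up to powers; [f_j(a, a b)] cancels [(b)_j],
   and [qfall_pochhammer_sum] applies. *)
pose X := q / (c * q ^+ n).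
have -> : \sum_(j < n.+1) qpoch q (q ^- n) j * qpoch q A j * qfall q a (a * b) j
    / (qpoch q (a * b) j * qpoch q b j * qpoch q q j) * (q / (a * c)) ^+ j
  = qpoch q X n / qpoch q (a * b) n.
  rewrite -(qfall_pochhammer_sum X (a * b) n q0 q1) mulr_suml.
  apply: eq_bigr => j _; have jn : (j <= n)%N by rewrite -ltnS.
  have e1 : qpoch q (a * b) n
      = qpoch q (a * b) j * qpoch q (a * b * q ^+ j) (n - j).
    by rewrite -qpochD subnKC.
  move: (abz n); rewrite e1 mulf_eq0 negb_or => /andP[ab2 ab3].
  have e2 : qpoch q A j = q ^+ (n * j) * qfall q X (a * b) j / (q / c) ^+ j.
    apply: (canRL (mulfK _)); first by rewrite expf_neq0 // mulf_neq0 ?invr_eq0.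
    rewrite mulrC exprM -!qfall_scale mulr1; congr qfall.
      by rewrite /X; field; rewrite c0 expf_neq0.
    by rewrite mulrAC [q * A]mulrC Aq; field.
  have := qfall_exprn q jn => /(canRL (mulfK (qz _))) e3.
  have e4 : qfall q a (a * b) j = a ^+ j * qpoch q b j.
    exact: qfall_mulr.
  rewrite qpoch_exprVn // e2 e3 e4 /qbin !expr_div_n exprMn.
  by field; rewrite !expf_neq0 // ab2 ab3 bz !qz.
(* Reversal: [(X)_n] is [(c)_n] read backwards, as [c^-1 q = X q^n]. *)
have e5 : qfall q 0 (a * c) n * qpoch q X n = a ^+ n * qpoch q c n.
  have e : qfall q c^-1 1 n = qfall q 0 1 n * qpoch q X n.
    by apply: qfall_reverse => //; rewrite /X; field; rewrite c0 expf_neq0.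
  have -> : qfall q 0 (a * c) n = a ^+ n * c ^+ n * qfall q 0 1 n.
    by rewrite -exprMn -qfall_scale mulr0 mulr1.
  by rewrite -!mulrA -e -qfall_scale divff // mulr1.
transitivity (qfall q 0 (a * c) n * qpoch q X n * qpoch q b n
  / (qpoch q (a * b) n * qpoch q (a * c) n)).
  by field; rewrite abz acz.
by rewrite e5; ring.
Qed.

Theorem mainTheorem8 (R : realFieldType) (q a b c : R) (N : nat)
    (q_gt0 : 0 < q) (q_lt1 : q < 1) (N_ge1 : (1 <= N)%N)
    (a_gt0 : 0 < a) (a_lt1 : a < 1) (b_lt1 : b < 1)
    (c_gt0 : 0 < c) (c_lt1 : c < 1) :
  [/\ forall x y : 'I_N.+1, 0 <= kernel q N a b c x y,
      forall y : 'I_N.+1, \sum_(x < N.+1) kernel q N a b c x y = 1,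
      forall x y : 'I_N.+1,
        kernel q N a b c x y * qHahn q y N c (a * b)
        = kernel q N a b c y x * qHahn q x N c (a * b),
      forall n x : 'I_N.+1,
        \sum_(y < N.+1) kernel q N a b c x y * qHahn q y N c (a * b)
                          * qHahnPoly q N n y c (a * b)
        = kappa q a b c n * qHahn q x N c (a * b)
          * qHahnPoly q N n x c (a * b)
    & forall n : 'I_N.+1,
        kappa q a b c n
        = a ^+ n * qpoch q b n * qpoch q c n
          / (qpoch q (a * b) n * qpoch q (a * c) n)].

Proof.
have ab1 : a * b < 1.
  by apply: le_lt_trans a_lt1; rewrite ler_piMr // ltW.
have ac1 : a * c < 1.
  by apply: le_lt_trans a_lt1; rewrite ler_piMr // ltW.
have qn0 : q != 0 by rewrite lt0r_neq0.
have abz i : qpoch q (a * b) i != 0 by rewrite qpoch_neq0.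
have caz i : qpoch q (c * a) i != 0 by rewrite qpoch_neq0 // mulrC.
split.
- move=> x y; apply: sumr_ge0 => z _.
  by apply: mulr_ge0; apply: qHahn_ge0 => //; rewrite mulrC.
- move=> y; have yN : (y <= N)%N by rewrite -ltnS.
  transitivity (\sum_(x < N.+1) kernel q N a b c x y * 1).
    by apply: eq_bigr => x _; rewrite mulr1.
  (* With the constant function 1, both averages reduce to total masses. *)
  rewrite (kernel_sum _ _ _ _ (fun=> 1) yN).
  transitivity (\sum_(w < (N - y).+1) qHahn q w (N - y) a b); last exact: qHahn_sum.
  apply: eq_bigr => w _; rewrite -[RHS]mulr1; congr (_ * _).
  by under eq_bigr => x _ do rewrite mulr1; apply: qHahn_sum.
- by move=> x y; apply: kernel_reversible => //; rewrite -ltnS.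
- move=> n x; have xN : (x <= N)%N by rewrite -ltnS.
  have nN : (n <= N)%N by rewrite -ltnS.
  pose A := c * (a * b) * q ^ (n%:Z - 1).
  have Aq : A * q = a * b * c * q ^+ n.
    rewrite [a * b * c]mulrC /A -mulrA -{2}[q]expr1z -expfzDr // subrK.
    by [].
  (* Reversibility turns the sum into an average under [K(., x)], to which the two means apply in
     turn. *)
  transitivity (qHahn q x N c (a * b)
      * \sum_(y < N.+1) kernel q N a b c y x * phi32 q n A (q ^- y) c (q ^- N)).
    rewrite mulr_sumr; apply: eq_bigr => y _.
    have yN : (y <= N)%N by rewrite -ltnS.
    by rewrite kernel_reversible // mulrAC mulrC.
  rewrite (kernel_sum _ _ _ _ (fun y => phi32 q n A (q ^- y) c (q ^- N)) xN).
  under eq_bigr => w _ do rewrite phi32_qHahn_mean //.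
  rewrite phi32_qHahn_shift_mean ?lt0r_neq0 // kappaE ?lt0r_neq0 //.
  by rewrite mulrA [in LHS](mulrC (qHahn _ _ _ _ _)).
- by move=> n; apply: kappaE; rewrite ?lt0r_neq0.
Qed.
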